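(* For all $r,s\in\mathbb{Z}_+$ there exists a constant $c(r,s)>0$ such that for every integer $n\ge 2r+1$ and every $y\in(-1,1)$ there exists an algebraic polynomial $p_{n,y}(x)$ in $x$ of degree at most $n$ satisfying, for all $x\in[-1,1]$, $$\big|\operatorname{sign}(x-y)-p_{n,y}(x)\big|\le c(r,s)\left(\frac{1-x^2}{1-x^2+1-y^2+\frac{1}{n^2}\,|\operatorname{sign}x-\operatorname{sign}y|}\right)^{r}\left(\frac{\delta_n(y)}{|x-y|+\delta_n(y)}\right)^{s},$$ where $\delta_n(y)=\frac{\sqrt{1-y^2}}{n}+\frac{1}{n^2}$.
   Context: $\operatorname{sign}t$ equals $1$ for $t>0$, $-1$ for $t<0$, and $0$ for $t=0$. $\mathbb{Z}_+=\{0,1,2,\dots\}$. *)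

(* Defs.v *)
From Stdlib Require Import Reals.
Open Scope R_scope.

Definition sgn (t : R) : R :=
  match Rlt_dec 0 t with
  | left _ => 1
  | right _ => match Rlt_dec t 0 with left _ => -1 | right _ => 0 end
  end.

Definition poly_eval (n : nat) (a : nat -> R) (x : R) : R :=
  sum_f_R0 (fun k => a k * x ^ k) n.

Definition delta_n (n : nat) (y : R) : R :=
  sqrt (1 - y ^ 2) / INR n + 1 / (INR n) ^ 2.

(* Main.v *)
Require Import Defs.
From Stdlib Require Import Reals Lra Lia.
Open Scope R_scope.

(** The approximant is the increasing function from [-1] to [1] on [[-1, 1]]
    whose derivative is proportional to [(1 - x^2)^r g(x)^(r+s+2)].  Here
    [x = cos t], [z = cos b], and [g] is the Fejer kernel [F_m] averaged over
    [t - b] and [t + b] and divided by [m^2]; it satisfies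
    [0 <= g(x) <= 6 d / (|x - z| + d)] with [d = sqrt (1 - z^2) / m], and
    [g >= 1/4] for [|x - z| <= d / 2].  The approximation error is then a tail
    of the normalised integral: the weight [(1 - x^2)^r] produces the first
    factor of the bound, the decay of the kernel the second.  The centre [z] is
    [y], moved inwards by [O(1/m^2)] when [y] is that close to an endpoint, and
    [m] is of the order of [n] with [m = 1] allowed, so that small [n] needs no
    separate treatment. *)

(** * Polynomials of bounded degree *)

Definition is_poly (n : nat) (f : R -> R) : Prop :=
  exists a, forall x, f x = poly_eval n a x.

Lemma is_poly_ext n f g :
  (forall x, f x = g x) -> is_poly n f -> is_poly n g.
Proof.
  intros H [a Ha]. exists a. intros x. rewrite <- H. apply Ha.
Qed.

Lemma is_poly_S n f : is_poly n f -> is_poly (S n) f.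
Proof.
  (* Nothing is known about [a] beyond index [n], so the new top coefficient has to be set to 0. *)
  intros [a Ha]. exists (fun k => if Nat.leb k n then a k else 0). intros x.
  rewrite Ha. unfold poly_eval. rewrite tech5.
  replace (Nat.leb (S n) n) with false by (symmetry; apply Nat.leb_gt; lia).
  rewrite Rmult_0_l, Rplus_0_r. apply sum_eq. intros i Hi.
  replace (Nat.leb i n) with true by (symmetry; apply Nat.leb_le; lia). reflexivity.
Qed.

Lemma is_poly_le n m f : (n <= m)%nat -> is_poly n f -> is_poly m f.
Proof.
  intros H Hf. induction H as [|m _ IH]; [exact Hf | apply is_poly_S, IH].
Qed.

Lemma is_poly_const n c : is_poly n (fun _ => c).
Proof.
  apply is_poly_le with 0%nat; [lia|].
  exists (fun _ => c). intros x. unfold poly_eval. simpl. ring.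
Qed.

Lemma is_poly_add n f g :
  is_poly n f -> is_poly n g -> is_poly n (fun x => f x + g x).
Proof.
  intros [a Ha] [b Hb]. exists (fun k => a k + b k). intros x.
  rewrite Ha, Hb. unfold poly_eval. rewrite <- plus_sum.
  apply sum_eq. intros. ring.
Qed.

Lemma is_poly_scal n c f : is_poly n f -> is_poly n (fun x => c * f x).
Proof.
  intros [a Ha]. exists (fun k => c * a k). intros x.
  rewrite Ha. unfold poly_eval. rewrite scal_sum.
  apply sum_eq. intros. ring.
Qed.

Lemma is_poly_mul_x n f : is_poly n f -> is_poly (S n) (fun x => x * f x).
Proof.
  intros [a Ha]. exists (fun k => match k with O => 0 | S j => a j end).
  intros x. rewrite Ha. clear Ha f. unfold poly_eval. induction n as [|n IH].
  - simpl. ring.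
  - rewrite (tech5 _ n), Rmult_plus_distr_l, IH, (tech5 _ (S n)). simpl. ring.
Qed.

Lemma is_poly_mul_pow n m g :
  is_poly m g -> is_poly (n + m) (fun x => x ^ n * g x).
Proof.
  intros Hg. induction n as [|n IH].
  - apply is_poly_ext with g; [intros; simpl; ring | exact Hg].
  - apply is_poly_ext with (fun x => x * (x ^ n * g x)); [intros; simpl; ring|].
    apply is_poly_mul_x, IH.
Qed.

Lemma is_poly_mul n m f g :
  is_poly n f -> is_poly m g -> is_poly (n + m) (fun x => f x * g x).
Proof.
  intros [a Ha] Hg.
  apply is_poly_ext with (fun x => poly_eval n a x * g x);
    [intros; rewrite Ha; reflexivity|].
  clear Ha f. induction n as [|n IH].
  - apply is_poly_ext with (fun x => a O * g x);
      [intros; unfold poly_eval; simpl; ring|].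
    apply is_poly_scal, Hg.
  - apply is_poly_ext with
      (fun x => poly_eval n a x * g x + a (S n) * (x ^ S n * g x));
      [intros; unfold poly_eval; rewrite tech5; ring|].
    apply is_poly_add; [apply is_poly_S, IH | apply is_poly_scal, is_poly_mul_pow, Hg].
Qed.

Lemma is_poly_pow k n f : is_poly n f -> is_poly (k * n) (fun x => f x ^ k).
Proof.
  intros Hf. induction k as [|k IH]; simpl.
  - apply is_poly_const.
  - apply is_poly_mul; assumption.
Qed.

Lemma is_poly_reflect n f : is_poly n f -> is_poly n (fun x => f (- x)).
Proof.
  intros [a Ha]. exists (fun k => a k * (-1) ^ k). intros x. rewrite Ha.
  unfold poly_eval. apply sum_eq. intros i _.
  replace (- x) with (-1 * x) by ring. rewrite Rpow_mult_distr. ring.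
Qed.

(** Replaces integration: every integral below is a difference of two values of such a primitive. *)
Lemma is_poly_primitive n f : is_poly n f ->
  exists F, is_poly (S n) F /\ forall x, derivable_pt_lim F x (f x).
Proof.
  intros [a Ha].
  assert (H : exists F, is_poly (S n) F /\
                forall x, derivable_pt_lim F x (poly_eval n a x)).
  { clear Ha f. unfold poly_eval. induction n as [|n (F & HF & HdF)].
    - exists (fun x => a O * x). split.
      (* In degree 1 only the indices 0 and 1 are read, so [INR] lists the coefficients of [x]. *)
      + apply is_poly_scal. exists (fun k => INR k). intros x.
        unfold poly_eval. simpl. ring.
      + intros x. simpl. apply (derivable_pt_lim_scal id), derivable_pt_lim_id.
    - exists (fun x => F x + a (S n) / INR (S (S n)) * x ^ S (S n)). split.
      + apply is_poly_add; [apply is_poly_S, HF|]. apply is_poly_scal.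
        apply is_poly_ext with (fun x => x ^ S (S n) * 1); [intros; ring|].
        replace (S (S n)) with (S (S n) + 0)%nat at 1 by lia.
        apply is_poly_mul_pow, is_poly_const.
      + intros x. rewrite tech5.
        apply (derivable_pt_lim_plus F _ x _ _ (HdF x)).
        replace (a (S n) * x ^ S n)
          with (a (S n) / INR (S (S n)) * (INR (S (S n)) * x ^ pred (S (S n))))
          by (simpl pred; field; apply not_0_INR; lia).
        apply (derivable_pt_lim_scal (fun x => x ^ S (S n))), derivable_pt_lim_pow. }
  destruct H as (F & HF & HdF). exists F. split; [exact HF|].
  intros x. rewrite Ha. apply HdF.
Qed.

(** * Chebyshev polynomials *)

Fixpoint cheb (j : nat) (x : R) : R :=
  match j with
  | O => 1
  | S i => match i with
           | O => x
           | S h => 2 * x * cheb i x - cheb h x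
           end
  end.

Lemma cheb_SS j x : cheb (S (S j)) x = 2 * x * cheb (S j) x - cheb j x.
Proof. reflexivity. Qed.

Lemma cos_mult_SS j t :
  cos (INR (S (S j)) * t) = 2 * cos t * cos (INR (S j) * t) - cos (INR j * t).
Proof.
  replace (INR (S (S j)) * t) with (INR (S j) * t + t) by (rewrite (S_INR (S j)); ring).
  replace (INR j * t) with (INR (S j) * t - t) by (rewrite (S_INR j); ring).
  rewrite cos_plus, cos_minus. ring.
Qed.

Lemma cheb_cos j t : cheb j (cos t) = cos (INR j * t).
Proof.
  assert (H : cheb j (cos t) = cos (INR j * t) /\
              cheb (S j) (cos t) = cos (INR (S j) * t)).
  { induction j as [|j [IH1 IH2]].
    - split; simpl; [rewrite Rmult_0_l, cos_0 | rewrite Rmult_1_l]; reflexivity.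
    - split; [exact IH2|]. rewrite cheb_SS, cos_mult_SS, IH1, IH2. reflexivity. }
  apply H.
Qed.

Lemma is_poly_cheb j : is_poly j (cheb j).
Proof.
  assert (H : is_poly j (cheb j) /\ is_poly (S j) (cheb (S j))).
  { induction j as [|j [IH1 IH2]].
    - split; [apply is_poly_const|].
      exists (fun k => INR k). intros x. unfold poly_eval. simpl. ring.
    - split; [exact IH2|].
      apply is_poly_ext with (fun x => 2 * (x * cheb (S j) x) + (-1) * cheb j x);
        [intros; rewrite cheb_SS; ring|].
      apply is_poly_add; apply is_poly_scal;
        [apply is_poly_mul_x, IH2 | apply is_poly_S, is_poly_S, IH1]. }
  apply H.
Qed.

(** * Dirichlet and Fejer sums of a sequence *)

(** Sum of [c_|j|] over [|j| <= m]. The sequence stays arbitrary because both cosines and products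
    of Chebyshev polynomials are inserted later. *)
Fixpoint dirichlet (c : nat -> R) (m : nat) : R :=
  match m with
  | O => c O
  | S k => dirichlet c k + 2 * c (S k)
  end.

(* [fejer c m] is [sum_{|j|<m} (m - |j|) c_|j|]. *)
Fixpoint fejer (c : nat -> R) (m : nat) : R :=
  match m with
  | O => 0
  | S k => fejer c k + dirichlet c k
  end.

Lemma fejer_half_sum a b c m :
  (forall j, c j = (a j + b j) / 2) -> fejer c m = (fejer a m + fejer b m) / 2.
Proof.
  intros H.
  assert (HD : forall k, dirichlet c k = (dirichlet a k + dirichlet b k) / 2).
  { induction k as [|k IH]; simpl; rewrite ?IH, H; field. }
  induction m as [|m IH]; simpl; [field|]. rewrite IH, HD. field.
Qed.

(** The weights [m - |j|] are nonnegative and add up to [m ^ 2]; [fejer_ge] rests on the same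
    count. *)
Lemma fejer_le c m : (forall j, c j <= 1) -> fejer c m <= INR m ^ 2.
Proof.
  intros H.
  assert (HD : forall k, dirichlet c k <= 1 + 2 * INR k).
  { induction k as [|k IH].
    - simpl. specialize (H O). lra.
    - rewrite S_INR. simpl. specialize (H (S k)). lra. }
  induction m as [|m IH]; [simpl; lra|].
  rewrite S_INR. simpl fejer. specialize (HD m). nra.
Qed.

Lemma fejer_ge c m :
  (forall j, (j <= m)%nat -> 1 / 2 <= c j) -> INR m ^ 2 / 2 <= fejer c m.
Proof.
  induction m as [|m IH]; intros H; [simpl; lra|].
  assert (HD : forall k, (k <= m)%nat -> 1 / 2 + INR k <= dirichlet c k).
  { induction k as [|k IHk]; intros Hk.
    - simpl. specialize (H O ltac:(lia)). lra.
    - rewrite S_INR. simpl. specialize (H (S k) ltac:(lia)).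
      specialize (IHk ltac:(lia)). lra. }
  specialize (IH ltac:(intros; apply H; lia)). specialize (HD m ltac:(lia)).
  rewrite S_INR. simpl fejer. nra.
Qed.

(** [fejer c (S m)] reads [c] only up to index [m], so the degree is one below the order of the
    sum. *)
Lemma is_poly_fejer (c : nat -> R -> R) m :
  (forall j, is_poly j (c j)) -> is_poly m (fun x => fejer (fun j => c j x) (S m)).
Proof.
  intros H.
  assert (HD : forall k, is_poly k (fun x => dirichlet (fun j => c j x) k)).
  { induction k as [|k IH]; simpl; [apply H|].
    apply is_poly_add; [apply is_poly_S, IH | apply is_poly_scal, H]. }
  induction m as [|m IH].
  - apply is_poly_add; [apply is_poly_const | apply HD].
  - apply (is_poly_add _ _ (fun x => dirichlet (fun j => c j x) (S m)));
      [apply is_poly_S, IH | apply HD].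
Qed.

(** * The trigonometric Fejer kernel *)

Definition cosines (t : R) (j : nat) : R := cos (INR j * t).

(** Closed form of the Fejer kernel without division. It telescopes twice, since [1 - cos t] times
    the Dirichlet sum of order [k] is [cos (k t) - cos ((k + 1) t)]. *)
Lemma fejer_cos_identity t m :
  (1 - cos t) * fejer (cosines t) m = 1 - cos (INR m * t).
Proof.
  assert (HD : forall k, (1 - cos t) * dirichlet (cosines t) k
                         = cos (INR k * t) - cos (INR (S k) * t)).
  { induction k as [|k IH].
    - unfold cosines. simpl. rewrite Rmult_0_l, Rmult_1_l, cos_0. ring.
    - simpl dirichlet. rewrite Rmult_plus_distr_l, IH, cos_mult_SS.
      unfold cosines. ring. }
  induction m as [|m IH].
  - simpl. rewrite Rmult_0_l, cos_0. ring.
  - simpl fejer. rewrite Rmult_plus_distr_l, IH, HD. ring.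
Qed.

Lemma fejer_cos_le t m : fejer (cosines t) m <= INR m ^ 2.
Proof. apply fejer_le. intros j. apply COS_bound. Qed.

Lemma one_minus_cos_mult_le t m : 1 - cos (INR m * t) <= INR m ^ 2 * (1 - cos t).
Proof.
  rewrite <- fejer_cos_identity.
  pose proof (fejer_cos_le t m). pose proof (COS_bound t). nra.
Qed.

(** For [j <= m], [1 - cos (j t)] is at most [m ^ 2 (1 - cos t)], so all cosines in the sum are at
    least 1/2. *)
Lemma fejer_cos_near t m :
  INR m ^ 2 * (1 - cos t) <= 1 / 2 -> INR m ^ 2 / 2 <= fejer (cosines t) m.
Proof.
  intros H. apply fejer_ge. intros j Hj. unfold cosines.
  pose proof (one_minus_cos_mult_le t j) as H1.
  apply le_INR in Hj. pose proof (pos_INR j). pose proof (COS_bound t).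
  assert (INR j ^ 2 <= INR m ^ 2) by nra. nra.
Qed.

(** The identity decides the sign except where [cos t = 1]; there [fejer_cos_near] applies. *)
Lemma fejer_cos_nonneg t m : 0 <= fejer (cosines t) m.
Proof.
  pose proof (COS_bound t) as Ht. pose proof (fejer_cos_identity t m) as H.
  pose proof (COS_bound (INR m * t)).
  destruct (Req_dec (cos t) 1) as [E|E]; [|nra].
  pose proof (fejer_cos_near t m) as H1. rewrite E in H1.
  pose proof (pow2_ge_0 (INR m)). lra.
Qed.

(** With [u = 1 - cos t], the displacement of the cosine plus [d] is at most [d (2 + 2 m^2 u)].
    Multiplied by the kernel [F], the first term is controlled by [F <= m^2] and the second by
    [F u <= 2], which gives 2 + 4 = 6. *)
Lemma fejer_cos_decay b t m d :
  Rabs (sin b) <= INR m * d -> 1 <= INR m ^ 2 * d -> 0 < d ->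
  fejer (cosines t) m * (Rabs (cos (b + t) - cos b) + d) <= 6 * INR m ^ 2 * d.
Proof.
  intros H1 H2 Hd.
  set (F := fejer (cosines t) m). set (M := INR m) in *. set (u := 1 - cos t).
  assert (HF0 : 0 <= F) by apply fejer_cos_nonneg.
  assert (HF1 : F <= M ^ 2) by apply fejer_cos_le.
  assert (HFu : F * u <= 2).
  { unfold F, u. rewrite Rmult_comm, fejer_cos_identity.
    pose proof (COS_bound (INR m * t)). lra. }
  assert (Hu : 0 <= u) by (unfold u; pose proof (COS_bound t); lra).
  assert (HM : 0 <= M) by apply pos_INR.
  assert (Hs : Rabs (sin t) ^ 2 <= 2 * u).
  { rewrite pow2_abs. pose proof (sin2_cos2 t) as E. unfold Rsqr in E. unfold u. nra. }
  assert (Hx : Rabs (cos (b + t) - cos b) <= u + Rabs (sin b) * Rabs (sin t)).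
  { rewrite cos_plus.
    replace (cos b * cos t - sin b * sin t - cos b)
      with (- (cos b * u) + - (sin b * sin t)) by (unfold u; ring).
    eapply Rle_trans; [apply Rabs_triang|]. rewrite !Rabs_Ropp, !Rabs_mult.
    rewrite (Rabs_pos_eq u) by exact Hu.
    assert (Rabs (cos b) <= 1) by (apply Rabs_le; apply COS_bound). nra. }
  (* Arithmetic-geometric mean: [2 M |sin t| <= 1 + M^2 sin^2 t], where [sin^2 t <= 2 u]. *)
  assert (Hm : M * Rabs (sin t) <= 1 / 2 + M ^ 2 * u).
  { assert (M ^ 2 * Rabs (sin t) ^ 2 <= M ^ 2 * (2 * u)) by nra.
    pose proof (pow2_ge_0 (M * Rabs (sin t) - 1)). nra. }
  assert (Rabs (sin b) * Rabs (sin t) <= d * (1 / 2 + M ^ 2 * u)).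
  { pose proof (Rabs_pos (sin t)). nra. }
  assert (u <= d * (M ^ 2 * u)) by nra.
  assert (Hall : Rabs (cos (b + t) - cos b) + d <= d * (2 + 2 * (M ^ 2 * u))) by nra.
  apply Rle_trans with (F * (d * (2 + 2 * (M ^ 2 * u)))); [nra|].
  replace (F * (d * (2 + 2 * (M ^ 2 * u))))
    with (d * (2 * F + 2 * (M ^ 2 * (F * u)))) by ring.
  assert (M ^ 2 * (F * u) <= M ^ 2 * 2) by (pose proof (pow2_ge_0 M); nra).
  nra.
Qed.

(** * The algebraic kernel *)

(* With [x = cos t] and [z = cos b] this averages the Fejer kernel over the
   angles [t - b] and [t + b], which makes it an algebraic polynomial in [x]. *)
Definition kernel (m : nat) (z x : R) : R :=
  / INR m ^ 2 * fejer (fun j => cheb j x * cheb j z) m.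

Lemma is_poly_kernel m z : is_poly m (kernel (S m) z).
Proof.
  apply is_poly_scal, (is_poly_fejer (fun j x => cheb j x * cheb j z)). intros j.
  apply is_poly_ext with (fun x => cheb j z * cheb j x); [intros; ring|].
  apply is_poly_scal, is_poly_cheb.
Qed.

Lemma kernel_cos m t b :
  kernel m (cos b) (cos t)
  = / INR m ^ 2 * ((fejer (cosines (t - b)) m + fejer (cosines (t + b)) m) / 2).
Proof.
  unfold kernel. f_equal. apply fejer_half_sum. intros j.
  rewrite !cheb_cos. unfold cosines.
  rewrite Rmult_minus_distr_l, Rmult_plus_distr_l, cos_minus, cos_plus. field.
Qed.

Lemma kernel_nonneg m z x : -1 <= z <= 1 -> -1 <= x <= 1 -> 0 <= kernel m z x.
Proof.
  intros Hz Hx. rewrite <- (cos_acos z), <- (cos_acos x) by assumption.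
  rewrite kernel_cos. destruct m as [|m].
  (* For [m = 0] the value of the inverse of 0 does not matter, as the Fejer sums vanish. *)
  - simpl fejer. lra.
  - apply Rmult_le_pos.
    + apply Rlt_le, Rinv_0_lt_compat, pow_lt, lt_0_INR. lia.
    + pose proof (fejer_cos_nonneg (acos x - acos z) (S m)).
      pose proof (fejer_cos_nonneg (acos x + acos z) (S m)). lra.
Qed.

Lemma sin_acos_sqrt z : -1 <= z <= 1 -> sin (acos z) = sqrt (1 - z ^ 2).
Proof. intros Hz. rewrite sin_acos by exact Hz. f_equal. unfold Rsqr. ring. Qed.

(** Both averaged terms decay in [|x - z|]: the angle [t - b] leads from [b] to [t], the angle
    [t + b] from [-b] to [t], and [b] and [-b] have the same cosine [z]. *)
Lemma kernel_decay m z x d :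
  (0 < m)%nat -> -1 <= z <= 1 -> -1 <= x <= 1 ->
  sqrt (1 - z ^ 2) <= INR m * d -> 1 <= INR m ^ 2 * d -> 0 < d ->
  kernel m z x <= 6 * (d / (Rabs (x - z) + d)).
Proof.
  intros Hm Hz Hx Hs H1 Hd.
  assert (HM : 0 < INR m ^ 2) by (apply pow_lt, lt_0_INR, Hm).
  assert (HA : 0 < Rabs (x - z) + d) by (pose proof (Rabs_pos (x - z)); lra).
  assert (Hsin : Rabs (sin (acos z)) <= INR m * d).
  { rewrite sin_acos_sqrt by exact Hz. rewrite Rabs_pos_eq by apply sqrt_pos. exact Hs. }
  pose proof (fejer_cos_decay (acos z) (acos x - acos z) m d Hsin H1 Hd) as B1.
  rewrite <- Rabs_Ropp, <- sin_neg in Hsin.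
  pose proof (fejer_cos_decay (- acos z) (acos x + acos z) m d Hsin H1 Hd) as B2.
  replace (acos z + (acos x - acos z)) with (acos x) in B1 by ring.
  replace (- acos z + (acos x + acos z)) with (acos x) in B2 by ring.
  rewrite cos_neg in B2. rewrite !cos_acos in B1, B2 by assumption.
  rewrite <- (cos_acos z), <- (cos_acos x) at 1 by assumption.
  rewrite kernel_cos.
  set (F1 := fejer _ m) in *. set (F2 := fejer (cosines (acos x + _)) m) in *.
  set (A := Rabs (x - z) + d) in *. set (N := INR m ^ 2) in *.
  apply Rmult_le_reg_r with (N * A); [nra|].
  replace (/ N * ((F1 + F2) / 2) * (N * A)) with ((F1 * A + F2 * A) / 2) by (field; lra).
  replace (6 * (d / A) * (N * A)) with (6 * N * d) by (field; lra).
  lra.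
Qed.

(** Only the term at angle [t - b] is bounded below, by [m^2 / 2]; the other one is nonnegative, and
    averaging leaves 1/4. *)
Lemma kernel_near m z x :
  (0 < m)%nat -> -1 < z < 1 -> -1 <= x <= 1 ->
  Rabs (x - z) <= sqrt (1 - z ^ 2) / (2 * INR m) -> 1 / 4 <= kernel m z x.
Proof.
  intros Hm Hz Hx Hd.
  assert (HM : 0 < INR m) by (apply lt_0_INR, Hm).
  rewrite <- (cos_acos z), <- (cos_acos x) by lra. rewrite kernel_cos.
  assert (HF : INR m ^ 2 / 2 <= fejer (cosines (acos x - acos z)) m).
  { apply fejer_cos_near. rewrite cos_minus, !cos_acos, !sin_acos_sqrt by lra.
    set (S := sqrt (1 - x ^ 2)). set (s := sqrt (1 - z ^ 2)) in *.
    assert (HS : S * S = 1 - x ^ 2) by (apply sqrt_sqrt; nra).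
    assert (Hs : s * s = 1 - z ^ 2) by (apply sqrt_sqrt; nra).
    assert (HS0 : 0 <= S) by apply sqrt_pos.
    assert (Hs0 : 0 < s) by (apply sqrt_lt_R0; nra).
    set (u := 1 - (x * z + S * s)).
    (* Here [u = 1 - cos (t - b)]. Multiplying by the conjugate factor turns it into [(x - z)^2],
       and that factor is at least [s^2 / 2], so [x] near [z] forces [u] to be small. *)
    assert (Huv : u * (1 - x * z + S * s) = (x - z) ^ 2).
    { unfold u. replace ((1 - (x * z + S * s)) * (1 - x * z + S * s))
        with ((1 - x * z) ^ 2 - (S * S) * (s * s)) by ring.
      rewrite HS, Hs. ring. }
    assert (Hv : s * s / 2 <= 1 - x * z + S * s).
    { assert (0 <= S * s) by nra. assert (0 <= S * S) by nra.
      pose proof (pow2_ge_0 (x - z)). lra. }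
    assert (Hxz : (x - z) ^ 2 * (4 * INR m ^ 2) <= s * s).
    { rewrite <- pow2_abs. pose proof (Rabs_pos (x - z)) as Hp.
      assert (Hq : Rabs (x - z) * (2 * INR m) <= s).
      { apply Rmult_le_reg_r with (/ (2 * INR m)); [apply Rinv_0_lt_compat; lra|].
        rewrite Rmult_assoc, Rinv_r, Rmult_1_r by lra. exact Hd. }
      assert (0 <= Rabs (x - z) * (2 * INR m)) by nra. nra. }
    assert (0 < s * s) by nra.
    assert (Hu : 0 <= u).
    { destruct (Rle_lt_dec 0 u) as [|Hn]; [assumption|]. exfalso.
      pose proof (pow2_ge_0 (x - z)) as H0. rewrite <- Huv in H0. nra. }
    replace (x * z + S * s) with (1 - u) by (unfold u; ring).
    assert (u * (s * s / 2) <= (x - z) ^ 2)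
      by (rewrite <- Huv; apply Rmult_le_compat_l; assumption).
    assert (HM2 : 0 < INR m ^ 2) by (apply pow_lt, HM).
    apply Rmult_le_reg_r with (s * s); [assumption|]. nra. }
  pose proof (fejer_cos_nonneg (acos x + acos z) m).
  assert (HM2 : 0 < INR m ^ 2) by (apply pow_lt, HM).
  apply Rmult_le_reg_l with (INR m ^ 2); [exact HM2|].
  rewrite <- Rmult_assoc, Rinv_r by lra. lra.
Qed.

(** * Tails and mass, expressed by primitives *)

(** Monotonicity of the integral, from the mean value theorem for [Q - H]. *)
Lemma increment_le Q q H h a b :
  a <= b ->
  (forall t, a <= t <= b -> derivable_pt_lim Q t (q t)) ->
  (forall t, a <= t <= b -> derivable_pt_lim H t (h t)) ->
  (forall t, a <= t <= b -> q t <= h t) ->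
  Q b - Q a <= H b - H a.
Proof.
  intros Hab HQ HH Hqh. destruct Hab as [Hab | ->]; [|lra].
  destruct (MVT_cor2 (fun t => Q t - H t) (fun t => q t - h t) a b Hab) as (c & E & Hc).
  - intros t Ht. apply (derivable_pt_lim_minus Q H); auto.
  - specialize (Hqh c ltac:(lra)). nra.
Qed.

Lemma derivable_pt_lim_tail_primitive d z k t :
  0 < t - z + d ->
  derivable_pt_lim (fun t => - d * (d / (t - z + d)) ^ S k) t
    (INR (S k) * (d / (t - z + d)) ^ (k + 2)).
Proof.
  intros Hp.
  assert (HW : derivable_pt_lim (fun t => d / (t - z + d)) t
                 ((0 * (t - z + d) - (1 - 0 + 0) * d) / Rsqr (t - z + d))).
  { apply (derivable_pt_lim_div (fct_cte d) (fun t => t - z + d)).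
    - apply derivable_pt_lim_const.
    - apply (derivable_pt_lim_plus (fun t => t - z) (fct_cte d));
        [|apply derivable_pt_lim_const].
      apply (derivable_pt_lim_minus id (fct_cte z));
        [apply derivable_pt_lim_id | apply derivable_pt_lim_const].
    - lra. }
  pose proof (derivable_pt_lim_comp _ (fun u => u ^ S k) t _ _ HW
                (derivable_pt_lim_pow _ (S k))) as HP.
  apply (derivable_pt_lim_scal _ (- d)) in HP.
  replace (INR (S k) * (d / (t - z + d)) ^ (k + 2))
    with (- d * (INR (S k) * (d / (t - z + d)) ^ pred (S k) *
            ((0 * (t - z + d) - (1 - 0 + 0) * d) / Rsqr (t - z + d)))).
  - exact HP.
  - rewrite pow_add. simpl pred. unfold Rsqr. simpl (_ ^ 2). field. lra.
Qed.

Lemma ratio_bounds d A : 0 < d -> 0 <= A -> 0 < d / (A + d) <= 1.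
Proof.
  intros Hd HA. split.
  - apply Rdiv_lt_0_compat; lra.
  - apply Rmult_le_reg_r with (A + d); [lra|].
    unfold Rdiv. rewrite Rmult_assoc, Rinv_l by lra. lra.
Qed.

(** Integrating the power [k + 2] of the decay factor yields a factor [d] and costs one power;
    another is given away because the factor is at most 1. The boundary term at 1 has a favourable
    sign and is dropped. *)
Lemma tail_le Q q d z k B x :
  0 < d -> 0 <= B -> z <= x <= 1 ->
  (forall t, derivable_pt_lim Q t (q t)) ->
  (forall t, x <= t <= 1 -> q t <= B * (d / (Rabs (t - z) + d)) ^ (k + 2)) ->
  Q 1 - Q x <= B * d * (d / (Rabs (x - z) + d)) ^ k.
Proof.
  intros Hd HB Hx HQ Hq.
  pose proof (increment_le Q q
    (fun t => B * (- d * (d / (t - z + d)) ^ S k))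
    (fun t => B * (INR (S k) * (d / (t - z + d)) ^ (k + 2))) x 1) as Hi.
  assert (Hle : Q 1 - Q x <= B * (- d * (d / (1 - z + d)) ^ S k)
                             - B * (- d * (d / (x - z + d)) ^ S k)).
  { apply Hi; [lra | intros; apply HQ | | ].
    - intros t Ht.
      apply (derivable_pt_lim_scal (fun t => - d * (d / (t - z + d)) ^ S k)).
      apply derivable_pt_lim_tail_primitive. lra.
    - intros t Ht. eapply Rle_trans; [apply Hq, Ht|].
      rewrite Rabs_pos_eq by lra.
      destruct (ratio_bounds d (t - z)) as [W0 _]; [lra|lra|].
      apply Rmult_le_compat_l; [exact HB|].
      pose proof (pow_lt _ (k + 2) W0). pose proof (pos_INR k). rewrite S_INR. nra. }
  rewrite Rabs_pos_eq by lra.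
  destruct (ratio_bounds d (x - z)) as [W0 W1]; [lra|lra|].
  destruct (ratio_bounds d (1 - z)) as [V0 _]; [lra|lra|].
  pose proof (pow_lt _ (S k) V0) as V. pose proof (pow_lt _ k W0) as W.
  simpl pow in Hle at 2. simpl pow in V.
  set (w := d / (x - z + d)) in *.
  assert (HBd : 0 <= B * d) by nra.
  assert (w * w ^ k <= w ^ k) by nra.
  assert (0 <= B * d * (d / (1 - z + d)) ^ S k) by (apply Rmult_le_pos; [nra | simpl; lra]).
  assert (B * d * (w * w ^ k) <= B * d * w ^ k) by nra.
  change (w ^ S k) with (w * w ^ k) in Hle. lra.
Qed.

(** Of the [r + (s + 2)] decay factors [w], [r] are paired with the weight through the pointwise
    bound [(1 - t^2) w <= 4 Z rho] for [t >= x]. The remaining [s + 2] are left to [tail_le]. *)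
Lemma weighted_tail_le Q q r s A d z x :
  0 < d -> d <= 1 - z ^ 2 -> 0 <= A -> -1 <= x <= 1 -> z <= x ->
  (forall t, derivable_pt_lim Q t (q t)) ->
  (forall t, -1 <= t <= 1 ->
     q t <= A * ((1 - t ^ 2) ^ r * (d / (Rabs (t - z) + d)) ^ (r + (s + 2)))) ->
  Q 1 - Q x <= A * (4 * (1 - z ^ 2) * ((1 - x ^ 2) / (1 - x ^ 2 + (1 - z ^ 2)))) ^ r
               * d * (d / (Rabs (x - z) + d)) ^ s.
Proof.
  intros Hd Hdz HA Hx Hzx HQ Hq.
  set (X := 1 - x ^ 2). set (Z := 1 - z ^ 2) in *.
  assert (HX : 0 <= X) by (unfold X; nra).
  assert (HZ : 0 < Z) by lra.
  set (rho := X / (X + Z)).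
  assert (Hrho : rho * (X + Z) = X) by (unfold rho; field; lra).
  assert (Hrho0 : 0 <= rho) by nra.
  apply tail_le with q; [exact Hd | | lra | exact HQ |].
  { apply Rmult_le_pos; [exact HA|]. apply pow_le. nra. }
  intros t Ht. eapply Rle_trans; [apply Hq; lra|].
  rewrite Rmult_assoc. apply Rmult_le_compat_l; [exact HA|].
  destruct (ratio_bounds d (Rabs (t - z))) as [W0 W1]; [lra | apply Rabs_pos |].
  assert (HW : d / (Rabs (t - z) + d) * (Rabs (t - z) + d) = d)
    by (field; pose proof (Rabs_pos (t - z)); lra).
  rewrite Rabs_pos_eq in * by lra.
  set (w := d / (t - z + d)) in *.
  rewrite pow_add, <- Rmult_assoc, <- Rpow_mult_distr.
  apply Rmult_le_compat_r; [apply pow_le; lra|].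
  assert (Ht0 : 0 <= 1 - t ^ 2) by nra.
  apply pow_incr. split; [nra|].
  destruct (Rlt_le_dec X Z) as [HXZ | HXZ].
  (* Since [z <= x], [X < Z] forces [x >= 0]; hence [1 - t^2 <= X = rho (X + Z) <= 2 rho Z]. *)
  - assert (H0x : 0 <= x).
    { destruct (Rle_lt_dec 0 x); [assumption|]. exfalso. unfold X, Z in HXZ. nra. }
    assert (1 - t ^ 2 <= X) by (unfold X; nra).
    assert (rho * X <= rho * Z) by nra.
    assert ((1 - t ^ 2) * w <= (1 - t ^ 2) * 1)
      by (apply Rmult_le_compat_l; assumption).
    lra.
  (* The weight grows at most linearly away from [z], and the decay absorbs this growth:
     [(t - z) w = (1 - w) d <= (1 - w) Z]. *)
  - assert (1 / 2 <= rho) by nra.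
    assert (Hz : -1 < z) by (unfold Z in HZ; nra).
    assert (1 - t ^ 2 <= Z + 2 * (t - z)) by (unfold Z; nra).
    assert ((1 - t ^ 2) * w <= (Z + 2 * (t - z)) * w)
      by (apply Rmult_le_compat_r; lra).
    assert ((1 - w) * d <= (1 - w) * Z) by (apply Rmult_le_compat_l; lra).
    assert (0 <= Z * w) by (apply Rmult_le_pos; lra).
    assert (Z * (1 / 2) <= Z * rho) by (apply Rmult_le_compat_l; lra).
    lra.
Qed.

Lemma mass_ge Q q d z l :
  (forall t, derivable_pt_lim Q t (q t)) -> 0 < d ->
  -1 <= z - d / 4 -> z + d / 4 <= 1 ->
  (forall t, -1 <= t <= 1 -> 0 <= q t) ->
  (forall t, Rabs (t - z) <= d / 4 -> l <= q t) ->
  d / 2 * l <= Q 1 - Q (-1).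
Proof.
  intros HQ Hd H1 H2 H0 Hl.
  assert (HC : forall t, derivable_pt_lim (fct_cte 0) t 0)
    by (intros; apply derivable_pt_lim_const).
  pose proof (increment_le (fct_cte 0) (fun _ => 0) Q q (-1) (z - d / 4)) as I1.
  pose proof (increment_le (fct_cte 0) (fun _ => 0) Q q (z + d / 4) 1) as I2.
  pose proof (increment_le (fun t => l * t) (fun _ => l * 1) Q q (z - d / 4) (z + d / 4)) as I3.
  unfold fct_cte in I1, I2.
  specialize (I1 H1 ltac:(auto) ltac:(auto) ltac:(intros; apply H0; lra)).
  specialize (I2 H2 ltac:(auto) ltac:(auto) ltac:(intros; apply H0; lra)).
  specialize (I3 ltac:(lra)).
  specialize (I3 ltac:(intros; apply (derivable_pt_lim_scal id), derivable_pt_lim_id)).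
  specialize (I3 ltac:(auto)).
  specialize (I3 ltac:(intros; rewrite Rmult_1_r; apply Hl, Rabs_le; lra)).
  lra.
Qed.

(** * The approximant around an interior centre *)

(** Quotient of tail bound and mass bound: [4 = 2 * 2] from the normalisation and the mass interval
    of length [d / 2], [8 = 4 * 2] from the weights [4 Z rho] and [Z / 2], [24 = 6 * 4] from the
    kernel bounds 6 and 1/4. *)
Definition approx_const (r s : nat) : R := 4 * 8 ^ r * 24 ^ (r + (s + 2)).

Lemma sign_approx r s m z d :
  (0 < m)%nat -> -1 < z < 1 -> / INR m ^ 2 <= 1 - z ^ 2 ->
  d = sqrt (1 - z ^ 2) / INR m ->
  exists p, is_poly (S (r * 2 + (r + (s + 2)) * pred m)) p /\
    forall x, -1 <= x <= 1 ->
      let e := approx_const r s * ((1 - x ^ 2) / (1 - x ^ 2 + (1 - z ^ 2))) ^ r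
               * (d / (Rabs (x - z) + d)) ^ s in
      -1 <= p x <= 1 /\ (z <= x -> 1 - p x <= e) /\ (x <= z -> 1 + p x <= e).
Proof.
  intros Hm Hz HmZ Ed.
  set (k := (r + (s + 2))%nat).
  set (q := fun x => (1 - x ^ 2) ^ r * kernel m z x ^ k).
  destruct (is_poly_primitive (r * 2 + k * pred m) q) as (Q & HQpoly & HQ).
  { apply is_poly_mul; apply is_poly_pow.
    - exists (fun j => match j with O => 1 | 1%nat => 0 | _ => -1 end).
      intros x. unfold poly_eval. simpl. ring.
    - destruct m as [|m]; [lia|]. apply is_poly_kernel. }
  assert (HM : 1 <= INR m) by (apply (le_INR 1); lia).
  set (sg := sqrt (1 - z ^ 2)) in *. set (Z := 1 - z ^ 2) in *.
  assert (HZ : 0 < Z) by (unfold Z; nra).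
  assert (Hsg : sg * sg = Z) by (apply sqrt_sqrt; lra).
  assert (Hsg0 : 0 < sg) by (apply sqrt_lt_R0; exact HZ).
  assert (HdM : d * INR m = sg) by (rewrite Ed; field; lra).
  assert (Hd : 0 < d) by (rewrite Ed; apply Rdiv_lt_0_compat; lra).
  (* As [d m = sg], this is the condition [1 <= m^2 d] of [kernel_decay], and it gives
     [d <= d (sg m) = Z]. *)
  assert (HsM : 1 <= sg * INR m).
  { assert (1 <= (sg * INR m) ^ 2).
    { replace ((sg * INR m) ^ 2) with (Z * INR m ^ 2) by (rewrite <- Hsg; ring).
      rewrite <- (Rinv_l (INR m ^ 2)) by nra.
      apply Rmult_le_compat_r; [nra | exact HmZ]. }
    assert (0 < sg * INR m) by nra. nra. }
  assert (HdZ : d <= Z).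
  { rewrite <- Hsg, <- HdM at 1. rewrite <- HdM at 1.
    replace (d * INR m * (d * INR m)) with (d * (sg * INR m)) by (rewrite <- HdM; ring).
    nra. }
  assert (Hq0 : forall t, -1 <= t <= 1 -> 0 <= q t).
  { intros t Ht. unfold q. apply Rmult_le_pos; apply pow_le; [nra|].
    apply kernel_nonneg; lra. }
  assert (Hq1 : forall t, -1 <= t <= 1 ->
            q t <= 6 ^ k * ((1 - t ^ 2) ^ r * (d / (Rabs (t - z) + d)) ^ k)).
  { intros t Ht. unfold q.
    replace (6 ^ k * ((1 - t ^ 2) ^ r * (d / (Rabs (t - z) + d)) ^ k))
      with ((1 - t ^ 2) ^ r * (6 * (d / (Rabs (t - z) + d))) ^ k)
      by (rewrite Rpow_mult_distr; ring).
    apply Rmult_le_compat_l; [apply pow_le; nra|].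
    apply pow_incr. split; [apply kernel_nonneg; lra|].
    apply kernel_decay; try assumption; try lra.
    - fold Z sg. lra.
    - replace (INR m ^ 2 * d) with (INR m * (d * INR m)) by ring. rewrite HdM. lra. }
  (* Within [d / 4] of [z] the weight changes by at most [d / 2 <= Z / 2], so it stays above
     [Z / 2]. *)
  assert (Hmass : d / 2 * ((Z / 2) ^ r * (1 / 4) ^ k) <= Q 1 - Q (-1)).
  { apply (mass_ge Q q d z); try assumption.
    - unfold Z in HdZ. nra.
    - unfold Z in HdZ. nra.
    - intros t Ht.
      assert (Ht' : z - d / 4 <= t <= z + d / 4)
        by (revert Ht; unfold Rabs; destruct (Rcase_abs (t - z)); lra).
      assert (Ht1 : -1 <= t <= 1) by (unfold Z in HdZ; nra).
      unfold q. apply Rmult_le_compat; try (apply pow_le; lra).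
      + apply pow_incr. split; [lra|]. unfold Z in *. nra.
      + apply pow_incr. split; [lra|].
        apply kernel_near; try assumption.
        fold Z sg. replace (sg / (2 * INR m)) with (d / 2) by (rewrite Ed; field; lra).
        lra. }
  set (I := Q 1 - Q (-1)) in *.
  assert (HI : 0 < I).
  { eapply Rlt_le_trans; [|exact Hmass].
    repeat apply Rmult_lt_0_compat; try apply pow_lt; lra. }
  assert (Hmono : forall a b, -1 <= a -> a <= b -> b <= 1 -> Q a <= Q b).
  { intros a b Ha Hab Hb.
    pose proof (increment_le (fct_cte 0) (fun _ => 0) Q q a b Hab) as H.
    specialize (H ltac:(intros; apply derivable_pt_lim_const) ltac:(auto)
                  ltac:(intros; apply Hq0; lra)). unfold fct_cte in H. lra. }
  (* Both tails are compared with the lower bound for the mass [I]. *)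
  assert (Hquot : forall x v T, 0 <= T -> -1 <= x <= 1 ->
            v <= 6 ^ k * (4 * Z * ((1 - x ^ 2) / (1 - x ^ 2 + Z))) ^ r * d * T ->
            2 / I * v <= approx_const r s * ((1 - x ^ 2) / (1 - x ^ 2 + Z)) ^ r * T).
  { intros x v T HT Hx Hv.
    set (rho := (1 - x ^ 2) / (1 - x ^ 2 + Z)) in *.
    assert (Hrho : 0 <= rho).
    { apply Rmult_le_pos; [nra|]. apply Rlt_le, Rinv_0_lt_compat. nra. }
    assert (Hrr : 0 <= approx_const r s * rho ^ r * T).
    { unfold approx_const. repeat apply Rmult_le_pos; try apply pow_le; lra. }
    replace (2 / I * v) with (2 * v / I) by (field; lra).
    apply Rmult_le_reg_r with I; [exact HI|].
    replace (2 * v / I * I) with (2 * v) by (field; lra).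
    eapply Rle_trans; [|apply Rmult_le_compat_l; [exact Hrr | exact Hmass]].
    replace (approx_const r s * rho ^ r * T * (d / 2 * ((Z / 2) ^ r * (1 / 4) ^ k)))
      with (2 * (6 ^ k * (4 * Z * rho) ^ r * d * T)); [lra|].
    unfold approx_const. fold k. unfold Rdiv. rewrite !Rpow_mult_distr, pow1.
    replace 8 with (4 * 2) by ring. replace 24 with (6 * 4) by ring.
    rewrite !Rpow_mult_distr, !pow_inv. field.
    split; apply pow_nonzero; lra. }
  exists (fun x => -1 + 2 / I * (Q x + - Q (-1))). split.
  { apply is_poly_add; [apply is_poly_const|]. apply is_poly_scal.
    apply is_poly_add; [exact HQpoly | apply is_poly_const]. }
  intros x Hx e.
  assert (HT : 0 <= (d / (Rabs (x - z) + d)) ^ s).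
  { apply pow_le. pose proof (ratio_bounds d _ Hd (Rabs_pos (x - z))). lra. }
  assert (H2I : 0 < 2 / I) by (apply Rdiv_lt_0_compat; lra).
  assert (EI : 2 / I * I = 2) by (field; lra).
  assert (E1 : 1 - (-1 + 2 / I * (Q x + - Q (-1))) = 2 / I * (Q 1 - Q x))
    by (unfold I in *; lra).
  assert (E2 : 1 + (-1 + 2 / I * (Q x + - Q (-1))) = 2 / I * (Q x - Q (-1))) by lra.
  split; [|split].
  - pose proof (Hmono (-1) x ltac:(lra) ltac:(lra) ltac:(lra)).
    pose proof (Hmono x 1 ltac:(lra) ltac:(lra) ltac:(lra)).
    assert (0 <= 2 / I * (Q 1 - Q x)) by (apply Rmult_le_pos; lra).
    assert (0 <= 2 / I * (Q x - Q (-1))) by (apply Rmult_le_pos; lra). lra.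
  - intros Hzx. rewrite E1. apply Hquot; [exact HT | exact Hx|].
    apply weighted_tail_le with q; try assumption. apply pow_le; lra.
  - intros Hzx. rewrite E2. apply Hquot; [exact HT | exact Hx|].
    (* The left tail is the right tail of the reflected primitive [- Q (- t)] about [- z]. *)
    replace (Q x - Q (-1)) with (- Q (- (1)) - - Q (- - x))
      by (rewrite Ropp_involutive; replace (- (1)) with (-1) by ring; ring).
    replace (Rabs (x - z)) with (Rabs (- x - - z))
      by (rewrite <- Rabs_Ropp; f_equal; ring).
    replace (x ^ 2) with ((- x) ^ 2) by ring.
    replace Z with (1 - (- z) ^ 2) in * by (unfold Z; ring).
    apply (weighted_tail_le (fun t => - Q (- t)) (fun t => q (- t)));
      try assumption; try lra.
    + apply pow_le; lra.
    + intros t. replace (q (- t)) with (- (q (- t) * (- 1))) by ring.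
      apply (derivable_pt_lim_opp (fun t => Q (- t))).
      apply (derivable_pt_lim_comp (fun t => - t) Q); [|apply HQ].
      apply (derivable_pt_lim_opp id), derivable_pt_lim_id.
    + intros t Ht. specialize (Hq1 (- t) ltac:(lra)).
      replace ((- t) ^ 2) with (t ^ 2) in Hq1 by ring.
      replace (Rabs (- t - z)) with (Rabs (t - - z)) in Hq1
        by (rewrite <- Rabs_Ropp; f_equal; ring).
      exact Hq1.
Qed.

(** * Passing from the interior centre to y *)

(** If [y] is too close to 1, the centre is the point with [1 - z^2 = 1 / M^2]; as [z >= z^2], it
    lies within [1 / M^2] of [y]. *)
Lemma choose_center y M : 0 <= y < 1 -> 1 <= M ->
  exists z, 0 <= z <= y /\ / M ^ 2 <= 1 - z ^ 2 /\ y - z <= / M ^ 2 /\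
    sqrt (1 - z ^ 2) <= sqrt (1 - y ^ 2) + / M.
Proof.
  intros Hy HM.
  assert (HM2 : 0 < / M ^ 2 <= 1).
  { split; [apply Rinv_0_lt_compat; nra|].
    rewrite <- Rinv_1. apply Rinv_le_contravar; nra. }
  assert (HMi : 0 < / M) by (apply Rinv_0_lt_compat; lra).
  destruct (Rle_lt_dec (/ M ^ 2) (1 - y ^ 2)) as [H | H].
  - exists y. lra.
  - set (z := sqrt (1 - / M ^ 2)).
    assert (Hz : z * z = 1 - / M ^ 2) by (apply sqrt_sqrt; lra).
    assert (Hz0 : 0 <= z) by apply sqrt_pos.
    exists z. assert (Hzy : z <= y) by nra.
    repeat split; try assumption; try nra.
    replace (1 - z ^ 2) with ((/ M) ^ 2) by (rewrite pow_inv; lra).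
    rewrite sqrt_pow2 by lra. pose proof (sqrt_pos (1 - y ^ 2)). lra.
Qed.

Lemma sgn_pos t : 0 < t -> sgn t = 1.
Proof. intros H. unfold sgn. destruct (Rlt_dec 0 t); [reflexivity | lra]. Qed.

Lemma sgn_neg t : t < 0 -> sgn t = -1.
Proof.
  intros H. unfold sgn. destruct (Rlt_dec 0 t); [lra|].
  destruct (Rlt_dec t 0); [reflexivity | lra].
Qed.

Lemma sgn_bounds t : -1 <= sgn t <= 1.
Proof. unfold sgn. destruct (Rlt_dec 0 t), (Rlt_dec t 0); lra. Qed.

Lemma sgn_opp t : sgn (- t) = - sgn t.
Proof.
  unfold sgn.
  destruct (Rlt_dec 0 t), (Rlt_dec (- t) 0), (Rlt_dec 0 (- t)), (Rlt_dec t 0); lra.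
Qed.

Definition majorant (r s n : nat) (y x : R) : R :=
  ((1 - x ^ 2) / (1 - x ^ 2 + (1 - y ^ 2) + / (INR n) ^ 2 * Rabs (sgn x - sgn y))) ^ r
  * (delta_n n y / (Rabs (x - y) + delta_n n y)) ^ s.

Lemma majorant_opp r s n y x : majorant r s n (- y) (- x) = majorant r s n y x.
Proof.
  unfold majorant, delta_n. rewrite !sgn_opp.
  replace ((- x) ^ 2) with (x ^ 2) by ring. replace ((- y) ^ 2) with (y ^ 2) by ring.
  replace (Rabs (- sgn x - - sgn y)) with (Rabs (sgn x - sgn y))
    by (rewrite <- Rabs_Ropp; f_equal; ring).
  replace (Rabs (- x - - y)) with (Rabs (x - y))
    by (rewrite <- Rabs_Ropp; f_equal; ring).
  reflexivity.
Qed.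

Lemma div_le_div a b K c d :
  0 <= a -> 0 < b -> 0 < d -> a * d <= K * c * b -> a / b <= K * (c / d).
Proof.
  intros Ha Hb Hd H. apply Rmult_le_reg_r with (b * d); [nra|].
  replace (a / b * (b * d)) with (a * d) by (field; lra).
  replace (K * (c / d) * (b * d)) with (K * c * b) by (field; lra). exact H.
Qed.

(** For [x > y] or [x < z] the signs relative to [y] and [z] agree, and moving the bound from [z] to
    [y] costs [3 ^ r * E ^ s]. Between [z] and [y] the error is at most 2, while the majorant is at
    least [1 / (4 ^ r * E ^ s)]. *)
Lemma sign_approx_nonneg r s n y :
  let E := INR (2 * r + 1 + (r + (s + 2))) ^ 2 + 1 in
  (n >= 2 * r + 1)%nat -> 0 <= y < 1 ->
  exists p, is_poly n p /\ forall x, -1 <= x <= 1 ->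
    Rabs (sgn (x - y) - p x)
    <= (approx_const r s * 3 ^ r * E ^ s + 2 * 4 ^ r * E ^ s) * majorant r s n y x.
Proof.
  intros E Hn Hy.
  set (k := (r + (s + 2))%nat) in *.
  (* The largest order for which the degree [2 r + 1 + k (m - 1)] does not exceed [n]; the natural
     subtraction is exact by [Hn]. *)
  set (m := S ((n - (2 * r + 1)) / k)).
  assert (Hk : (2 <= k)%nat) by (unfold k; lia).
  pose proof (Nat.div_mod (n - (2 * r + 1)) k ltac:(lia)) as Hdiv.
  pose proof (Nat.mod_upper_bound (n - (2 * r + 1)) k ltac:(lia)) as Hmod.
  assert (Hnm : (n <= (2 * r + 1 + k) * m)%nat).
  { assert ((2 * r + 1) * 1 <= (2 * r + 1) * m)%nat
      by (apply Nat.mul_le_mono_l; unfold m; lia).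
    rewrite Nat.mul_add_distr_r. unfold m at 2. rewrite Nat.mul_succ_r. lia. }
  assert (Hmn : (m <= n)%nat).
  { assert (1 * ((n - (2 * r + 1)) / k) <= k * ((n - (2 * r + 1)) / k))%nat
      by (apply Nat.mul_le_mono_r; lia).
    unfold m. lia. }
  set (B := INR (2 * r + 1 + k)) in *.
  assert (HnM : INR n <= B * INR m) by (unfold B; rewrite <- mult_INR; apply le_INR, Hnm).
  assert (HMn : INR m <= INR n) by (apply le_INR, Hmn).
  assert (HM : 1 <= INR m) by (apply (le_INR 1); unfold m; lia).
  assert (HB : 1 <= B) by (apply (le_INR 1); lia).
  destruct (choose_center y (INR m) Hy HM) as (z & Hz & HmZ & Hyz & Hs).
  set (d := sqrt (1 - z ^ 2) / INR m).
  destruct (sign_approx r s m z d) as (p & Hp & Happ);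
    [unfold m; lia | lra | exact HmZ | reflexivity |].
  exists p. split.
  { eapply is_poly_le; [|exact Hp]. fold k. unfold m. rewrite Nat.pred_succ. lia. }
  set (dl := delta_n n y).
  assert (HMinv : / INR m <= B * / INR n).
  { apply Rmult_le_reg_r with (INR m * INR n); [nra|].
    replace (/ INR m * (INR m * INR n)) with (INR n) by (field; lra).
    replace (B * / INR n * (INR m * INR n)) with (B * INR m) by (field; lra). exact HnM. }
  assert (HMi0 : 0 < / INR m) by (apply Rinv_0_lt_compat; lra).
  assert (HNi0 : 0 < / INR n) by (apply Rinv_0_lt_compat; lra).
  pose proof (sqrt_pos (1 - y ^ 2)) as Hsy. pose proof (sqrt_pos (1 - z ^ 2)) as Hsz.
  assert (Edl : dl = sqrt (1 - y ^ 2) * / INR n + (/ INR n) ^ 2)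
    by (unfold dl, delta_n; field; lra).
  assert (Hdl : 0 < dl) by (rewrite Edl; nra).
  assert (HB2 : B <= B ^ 2) by nra.
  assert (HM2 : (/ INR m) ^ 2 <= B ^ 2 * (/ INR n) ^ 2)
    by (rewrite <- Rpow_mult_distr; apply pow_incr; lra).
  assert (Hd : d <= B ^ 2 * dl).
  { unfold d, Rdiv. apply Rle_trans with ((sqrt (1 - y ^ 2) + / INR m) * / INR m); [nra|].
    assert (sqrt (1 - y ^ 2) * / INR m <= sqrt (1 - y ^ 2) * (B * / INR n))
      by (apply Rmult_le_compat_l; lra).
    assert (0 <= sqrt (1 - y ^ 2) * / INR n) by nra.
    assert (B * (sqrt (1 - y ^ 2) * / INR n) <= B ^ 2 * (sqrt (1 - y ^ 2) * / INR n))
      by (apply Rmult_le_compat_r; lra).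
    rewrite Edl. nra. }
  assert (Hyz' : y - z <= B ^ 2 * dl).
  { rewrite <- pow_inv in Hyz. rewrite Edl.
    assert (0 <= B ^ 2 * (sqrt (1 - y ^ 2) * / INR n))
      by (repeat apply Rmult_le_pos; nra). lra. }
  assert (Hd0 : 0 < d).
  { unfold d. apply Rdiv_lt_0_compat; [|lra]. apply sqrt_lt_R0. nra. }
  assert (HE : 1 <= E) by (unfold E; nra).
  assert (HEd : d <= E * dl) by (unfold E; nra).
  (* The summand 1 in [E = B^2 + 1] pays for [dl] itself. *)
  assert (HEyz : y - z + dl <= E * dl) by (unfold E; nra).
  assert (HnZ : / INR n ^ 2 <= 1 - z ^ 2).
  { eapply Rle_trans; [|exact HmZ]. apply Rinv_le_contravar; nra. }
  assert (Hn2 : 0 < / INR n ^ 2 <= 1).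
  { split; [apply Rinv_0_lt_compat; nra|].
    rewrite <- Rinv_1. apply Rinv_le_contravar; nra. }
  intros x Hx. specialize (Happ x Hx). cbv zeta in Happ.
  destruct Happ as (Hpx & Hright & Hleft).
  assert (HX : 0 <= 1 - x ^ 2) by (clear - Hx; nra).
  assert (HYZ : 0 < 1 - y ^ 2 <= 1 - z ^ 2) by (clear - Hy Hz; nra).
  set (D := 1 - x ^ 2 + (1 - y ^ 2) + / INR n ^ 2 * Rabs (sgn x - sgn y)).
  set (rho := (1 - x ^ 2) / D). set (w := dl / (Rabs (x - y) + dl)).
  change (majorant r s n y x) with (rho ^ r * w ^ s).
  assert (Hsg : 0 <= Rabs (sgn x - sgn y) <= 2).
  { split; [apply Rabs_pos|]. pose proof (sgn_bounds x). pose proof (sgn_bounds y).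
    apply Rabs_le. lra. }
  assert (HD : 0 < D).
  { assert (0 <= / INR n ^ 2 * Rabs (sgn x - sgn y)) by (apply Rmult_le_pos; lra).
    unfold D. lra. }
  assert (Hrho : 0 <= rho).
  { apply Rmult_le_pos; [exact HX|]. apply Rlt_le, Rinv_0_lt_compat, HD. }
  pose proof (Rabs_pos (x - y)) as Hxy. pose proof (Rabs_pos (x - z)) as Hxz.
  destruct (ratio_bounds dl _ Hdl Hxy) as [Hw _]. fold w in Hw.
  assert (Hrs : 0 <= rho ^ r * w ^ s) by (apply Rmult_le_pos; apply pow_le; lra).
  assert (Hapx : 0 <= approx_const r s).
  { unfold approx_const. repeat apply Rmult_le_pos; try apply pow_le; lra. }
  assert (HEs : 0 <= E ^ s) by (apply pow_le; lra).
  assert (H3 : 0 <= 3 ^ r) by (apply pow_le; lra).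
  assert (H4 : 0 <= 4 ^ r) by (apply pow_le; lra).
  assert (HC1 : 0 <= approx_const r s * 3 ^ r * E ^ s)
    by (apply Rmult_le_pos; [apply Rmult_le_pos|]; assumption).
  assert (HC2 : 0 <= 2 * 4 ^ r * E ^ s) by (repeat apply Rmult_le_pos; lra).
  assert (HS1 := Rmult_le_pos _ _ HC1 Hrs). assert (HS2 := Rmult_le_pos _ _ HC2 Hrs).
  rewrite Rmult_plus_distr_r.
  set (e := _ * _ ^ r * _ ^ s) in Hright, Hleft.
  assert (He : e <= approx_const r s * 3 ^ r * E ^ s * (rho ^ r * w ^ s)).
  { unfold e.
    replace (approx_const r s * 3 ^ r * E ^ s * (rho ^ r * w ^ s))
      with (approx_const r s * (3 * rho) ^ r * (E * w) ^ s)
      by (rewrite !Rpow_mult_distr; ring).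
    destruct (ratio_bounds d _ Hd0 Hxz) as [Hv _].
    assert (HDz : 0 < 1 - x ^ 2 + (1 - z ^ 2)) by lra.
    assert (HXz : 0 <= (1 - x ^ 2) / (1 - x ^ 2 + (1 - z ^ 2))).
    { apply Rmult_le_pos; [exact HX|]. apply Rlt_le, Rinv_0_lt_compat, HDz. }
    apply Rmult_le_compat.
    - apply Rmult_le_pos; [exact Hapx | apply pow_le, HXz].
    - apply pow_le. lra.
    - apply Rmult_le_compat_l; [exact Hapx|]. apply pow_incr. split; [exact HXz|].
      apply div_le_div; [exact HX | exact HDz | exact HD |].
      (* The sign term is at most [2 / n^2 <= 2 (1 - z^2)], and [1 - y^2 <= 1 - z^2]. *)
      assert (D <= 3 * (1 - x ^ 2 + (1 - z ^ 2))).
      { assert (/ INR n ^ 2 * Rabs (sgn x - sgn y) <= (1 - z ^ 2) * 2)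
          by (apply Rmult_le_compat; lra).
        unfold D. lra. }
      rewrite (Rmult_comm 3), Rmult_assoc. apply Rmult_le_compat_l; assumption.
    - apply pow_incr. split; [lra|].
      apply div_le_div; [lra | lra | lra |].
      assert (Htri : Rabs (x - y) <= Rabs (x - z) + (y - z)).
      { rewrite <- (Rabs_pos_eq (y - z)) by lra. rewrite <- (Rabs_Ropp (y - z)).
        replace (x - y) with (x - z + - (y - z)) by ring. apply Rabs_triang. }
      assert (d * (Rabs (x - y) + dl) <= d * (Rabs (x - z) + E * dl))
        by (apply Rmult_le_compat_l; lra).
      assert (d * Rabs (x - z) <= E * dl * Rabs (x - z))
        by (apply Rmult_le_compat_r; lra).
      lra. }
  assert (Hsgxy := sgn_bounds (x - y)).
  destruct (Rlt_le_dec y x) as [Hyx | Hyx].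
  - rewrite sgn_pos by lra. rewrite Rabs_pos_eq by lra.
    specialize (Hright ltac:(lra)). lra.
  - destruct (Rlt_le_dec x z) as [Hxlt | Hzx].
    + rewrite sgn_neg by lra. rewrite Rabs_left1 by lra.
      specialize (Hleft ltac:(lra)). lra.
    + assert (H2 : Rabs (sgn (x - y) - p x) <= 2) by (apply Rabs_le; lra).
      assert (Hrho4 : 1 <= 4 * rho).
      { unfold rho. replace 1 with (1 / 1) at 1 by field.
        apply div_le_div; [lra | lra | exact HD |].
        (* For [0 < x <= y] the signs coincide and [D <= 2 (1 - x^2)]. At [x = 0] the sign term may
           add up to 2, whence the constant 4. *)
        destruct (Rle_lt_or_eq_dec 0 x ltac:(lra)) as [Hx0 | <-].
        - unfold D. rewrite (sgn_pos x), (sgn_pos y) by lra.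
          rewrite Rminus_diag, Rabs_R0. clear - Hx0 Hyx Hy. nra.
        - assert (/ INR n ^ 2 * Rabs (sgn 0 - sgn y) <= 1 * 2)
            by (apply Rmult_le_compat; lra).
          assert (0 <= y ^ 2) by apply pow2_ge_0.
          unfold D. lra. }
      assert (HEw : 1 <= E * w).
      { unfold w. replace 1 with (1 / 1) at 1 by field.
        apply div_le_div; [lra | lra | lra |].
        rewrite Rabs_left1 by lra. lra. }
      assert (2 <= 2 * 4 ^ r * E ^ s * (rho ^ r * w ^ s)).
      { replace (2 * 4 ^ r * E ^ s * (rho ^ r * w ^ s))
          with (2 * ((4 * rho) ^ r * (E * w) ^ s)) by (rewrite !Rpow_mult_distr; ring).
        pose proof (pow_R1_Rle _ r Hrho4). pose proof (pow_R1_Rle _ s HEw).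
        assert (1 * 1 <= (4 * rho) ^ r * (E * w) ^ s) by (apply Rmult_le_compat; lra).
        lra. }
      lra.
Qed.

Theorem mainTheorem4 :
  forall r s : nat,
  exists c : R, c > 0 /\
    forall (n : nat) (y : R),
      (n >= 2 * r + 1)%nat ->
      -1 < y < 1 ->
      exists a : nat -> R,
        forall x : R, -1 <= x <= 1 ->
          Rabs (sgn (x - y) - poly_eval n a x) <=
            c * ((1 - x ^ 2) /
                   (1 - x ^ 2 + (1 - y ^ 2) + / (INR n) ^ 2 * Rabs (sgn x - sgn y))) ^ r
              * (delta_n n y / (Rabs (x - y) + delta_n n y)) ^ s.
Proof.
  intros r s.
  set (E := INR (2 * r + 1 + (r + (s + 2))) ^ 2 + 1).
  exists (approx_const r s * 3 ^ r * E ^ s + 2 * 4 ^ r * E ^ s). split.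
  { assert (HE : 0 < E) by (unfold E; nra).
    apply Rplus_lt_0_compat; unfold approx_const;
      repeat apply Rmult_lt_0_compat; try apply pow_lt; lra. }
  intros n y Hn Hy.
  assert (H : exists p, is_poly n p /\ forall x, -1 <= x <= 1 ->
    Rabs (sgn (x - y) - p x)
    <= (approx_const r s * 3 ^ r * E ^ s + 2 * 4 ^ r * E ^ s) * majorant r s n y x).
  { destruct (Rle_lt_dec 0 y) as [Hy0 | Hy0].
    - apply sign_approx_nonneg; [exact Hn | lra].
    (* Oddness of the sign: [- p (- x)] serves [y] when [p] serves [- y], and the majorant is
       invariant under the reflection. *)
    - destruct (sign_approx_nonneg r s n (- y)) as (p & Hp & Hb); [exact Hn | lra |].
      exists (fun x => -1 * p (- x)). split.
      + apply is_poly_scal, is_poly_reflect, Hp.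
      + intros x Hx. specialize (Hb (- x) ltac:(lra)). rewrite majorant_opp in Hb.
        replace (- x - - y) with (- (x - y)) in Hb by ring.
        rewrite sgn_opp, <- Rabs_Ropp in Hb.
        replace (sgn (x - y) - -1 * p (- x)) with (- (- sgn (x - y) - p (- x))) by ring.
        exact Hb. }
  destruct H as (p & [a Ha] & Hb). exists a. intros x Hx.
  rewrite <- Ha, Rmult_assoc. apply Hb, Hx.
Qed.
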